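(* Assume that the subproblems of the discrete source transfer preconditioner (matrix level, defined in the context) are well-posed (uniquely solvable). Then the discrete source transfer preconditioner is equivalent to one double sweep with zero initial guess of the discrete double sweep optimized Schwarz method (DOSM) in the specific case where each subdomain consists of two contacting overlaps, with PML transmission conditions on all interfaces in the forward sweep, PML conditions on the left interfaces and Dirichlet conditions on the right interfaces in the backward sweep, and with the source terms in the right overlap of each subdomain put to zero in the forward sweep (this specific DOSM is written out in the context). That is, the output $\tilde{\mathbf u}$ of the source transfer preconditioner equals $\mathbf u_j^{(1)}$ on $G_j\cup Z_j$ for $j=1,\dots,J$, and equals $\mathbf u_1^{(1)}$ on $Z_0$.
   Context: For index sets $X,Y$, $A[X,Y]$ is the submatrix with rows $X$ and columns $Y$, and $\mathbf v[X]$ is the restriction of $\mathbf v$ to $X$. Index sets. The global index set is the disjoint union of $Z_0,G_1,Z_1,G_2,Z_2,\dots,G_J,Z_J$ ($Z_j$: unknowns inside layer $O_j$; $G_j$: unknowns on $\Gamma_j=\partial O_{j-1}\cap\partial O_j$), where $O_0,\dots,O_J$ are non-overlapping, serially connected layers decomposing the domain, and the square matrix $A$ of the system $A\mathbf u=\mathbf f$ is block tridiagonal for this ordering. Subdomain $j\in\{1,\dots,J\}$ has unknowns $W_j=G_{j-1}\cup Z_{j-1}\cup G_j\cup Z_j\cup G_{j+1}$, with left interface $G_{j-1}$ and right interface $G_{j+1}$; $G_0$ and $G_{J+1}$ are empty and the corresponding rows and columns are deleted. $\tilde S_j^l$ (on $G_{j-1}$) and $\tilde S_j^r$ (on $G_{j+1}$)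 are given square matrices (the Schur complements obtained by eliminating the PML, i.e. perfectly matched layer, unknowns exterior to subdomain $j$ on the left, respectively right). $I_j$ is the identity matrix on $W_j$. Source transfer preconditioner. Let $\tilde{\mathbf f}_1=\mathbf f[Z_0]$. Forward, successively for $j=1,\dots,J-1$, solve for $\mathbf v_j\in\mathbb C^{W_j}$: $\tilde S_j^l\mathbf v_j[G_{j-1}]+A[G_{j-1},Z_{j-1}]\mathbf v_j[Z_{j-1}]=0$; $A[Z_{j-1},W_j]\mathbf v_j=\tilde{\mathbf f}_j$; $A[G_j,W_j]\mathbf v_j=\mathbf f[G_j]$; $A[Z_j,W_j]\mathbf v_j=0$; $A[G_{j+1},Z_j]\mathbf v_j[Z_j]+\tilde S_j^r\mathbf v_j[G_{j+1}]=0$; then set $\tilde{\mathbf f}_{j+1}=\mathbf f[Z_j]-A[Z_j,Z_j](D_j\mathbf v_j)[Z_j]-A[Z_j,G_j](D_j\mathbf v_j)[G_j]$. Here $D_j$ is a square matrix on $W_j$ whose rows satisfy the four conditions $D_j[G_{j+1},W_j]=0$, $\;A[G_{j+1},Z_j]\,D_j[Z_j,W_j]=0$, $\;(D_j-I_j)[G_j,W_j]=0$, $\;A[G_j,Z_j]\,(D_j-I_j)[Z_j,W_j]=0$. Backward, in order $j=J,\dots,1$, solve for $\tilde{\mathbf u}_j\in\mathbb C^{W_j}$: $\tilde S_j^l\tilde{\mathbf u}_j[G_{j-1}]+A[G_{j-1},Z_{j-1}]\tilde{\mathbf u}_j[Z_{j-1}]=0$; $A[Z_{j-1},W_j]\tilde{\mathbf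 u}_j=\tilde{\mathbf f}_j$; $A[G_j,W_j]\tilde{\mathbf u}_j=\mathbf f[G_j]$; $A[Z_j,W_j]\tilde{\mathbf u}_j=\mathbf f[Z_j]$; $\tilde{\mathbf u}_j[G_{j+1}]=\tilde{\mathbf u}_{j+1}[G_{j+1}]$. Output: $\tilde{\mathbf u}=\tilde{\mathbf u}_j$ on $G_j\cup Z_j$, $j=1,\dots,J$, and $\tilde{\mathbf u}=\tilde{\mathbf u}_1$ on $Z_0$. Specific DOSM (zero initial guess). Forward, successively for $j=1,\dots,J-1$, $\mathbf u_j^{(1/2)}\in\mathbb C^{W_j}$ solves $\tilde S_j^l\mathbf u_j^{(1/2)}[G_{j-1}]+A[G_{j-1},Z_{j-1}]\mathbf u_j^{(1/2)}[Z_{j-1}]=\mathbf h_j$; $A[Z_{j-1},W_j]\mathbf u_j^{(1/2)}=\mathbf f[Z_{j-1}]$; $A[G_j,W_j]\mathbf u_j^{(1/2)}=\mathbf f[G_j]$; $A[Z_j,W_j]\mathbf u_j^{(1/2)}=0$; $A[G_{j+1},Z_j]\mathbf u_j^{(1/2)}[Z_j]+\tilde S_j^r\mathbf u_j^{(1/2)}[G_{j+1}]=0$, where $\mathbf h_j=\mathbf f[G_{j-1}]+(\tilde S_j^l-A[G_{j-1},G_{j-1}])\mathbf u_{j-1}^{(1/2)}[G_{j-1}]-A[G_{j-1},Z_{j-2}]\mathbf u_{j-1}^{(1/2)}[Z_{j-2}]$ (absent for $j=1$). Backward, in order $j=J,\dots,1$, $\mathbf u_j^{(1)}\in\mathbb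 C^{W_j}$ solves $\tilde S_j^l\mathbf u_j^{(1)}[G_{j-1}]+A[G_{j-1},Z_{j-1}]\mathbf u_j^{(1)}[Z_{j-1}]=\mathbf h_j$; $A[X,W_j]\mathbf u_j^{(1)}=\mathbf f[X]$ for $X=Z_{j-1},G_j,Z_j$; $\mathbf u_j^{(1)}[G_{j+1}]=\mathbf u_{j+1}^{(1)}[G_{j+1}]$. *)

(* Defs.v *)
From HB Require Import structures.
From mathcomp Require Import all_boot all_order all_algebra.
From mathcomp Require Import reals.
From mathcomp Require Import complex.
Set Implicit Arguments.
Unset Strict Implicit.
Unset Printing Implicit Defensive.
Import GRing.Theory.
Local Open Scope ring_scope.

(* The unknowns are numbered by 'I_N, and an index set is an X : {set 'I_N}.
   A vector of C^X has type 'cV_#|X|, a square matrix on X has type 'M_#|X|;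
   the k-th coordinate belongs to the unknown enum_val k of X. *)
Section Submatrices.
Context {F : fieldType} {N : nat}.
Implicit Types X Y W : {set 'I_N}.

(* A[X,Y] *)
Definition submat (A : 'M[F]_N) X Y : 'M[F]_(#|X|, #|Y|) :=
  mxsub (fun i : 'I_#|X| => enum_val i) (fun k : 'I_#|Y| => enum_val k) A.

(* f[X] for a vector f on the whole index set *)
Definition grestr (f : 'cV[F]_N) X : 'cV[F]_#|X| :=
  rowsub (fun i : 'I_#|X| => enum_val i) f.

(* M[X] for a vector (or the rows of a matrix) M indexed by W, where X is
   included in W: the 0/1 matrix I[X,W] selects the entries of M in X,
   see restrE. *)
Definition restr W p (M : 'M[F]_(#|W|, p)) X : 'M[F]_(#|X|, p) :=
  submat 1%:M X W *m M.

Lemma restrE W p (M : 'M[F]_(#|W|, p)) X (i : 'I_#|X|) (l : 'I_#|W|) k :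
  enum_val l = enum_val i -> restr M X i k = M l k.
Proof.
move=> eli; rewrite mxE (bigD1 l) //= !mxE eli eqxx mul1r big1 ?addr0 // => m.
rewrite !mxE -eli (inj_eq enum_val_inj) eq_sym => /negPf ->.
by rewrite mul0r.
Qed.

End Submatrices.

Section Layers.
Context {N : nat}.
Variables (J : nat) (Z G : nat -> {set 'I_N}).

(* The k-th block, 0 <= k <= 2J, of the ordering Z_0,G_1,Z_1,...,G_J,Z_J. *)
Definition block (k : nat) : {set 'I_N} :=
  if odd k then G (uphalf k) else Z k./2.

(* Since G_0 and G_(J+1) are empty, matrices and vectors over them have no
   entries, so every row or column attached to them disappears. *)
Definition layered : Prop :=
  [/\ G 0 = set0, G J.+1 = set0,
      \bigcup_(k < J.*2.+1) block k = [set: 'I_N]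
    & forall k l : 'I_J.*2.+1, k != l -> [disjoint block k & block l]].

Definition block_tridiagonal {F : fieldType} (A : 'M[F]_N) : Prop :=
  forall k l : 'I_J.*2.+1, (k.+1 < l)%N || (l.+1 < k)%N ->
    submat A (block k) (block l) = 0.

(* W_j *)
Definition subdomain (j : nat) : {set 'I_N} :=
  G j.-1 :|: Z j.-1 :|: G j :|: Z j :|: G j.+1.

End Layers.

Section Algorithms.
Context {F : fieldType} {N : nat}.
Variables (J : nat) (Z G : nat -> {set 'I_N}) (A : 'M[F]_N).
Variables (Sl : forall j, 'M[F]_#|G j.-1|) (Sr : forall j, 'M[F]_#|G j.+1|).
Notation W := (subdomain Z G).
Variable D : forall j, 'M[F]_#|W j|.

(* Subproblem j with PML conditions on both sides and right-hand sides on
   G_(j-1), Z_(j-1), G_j, Z_j, G_(j+1), in this order. *)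
Definition forward_subproblem (j : nat)
    (bl : 'cV[F]_#|G j.-1|) (b1 : 'cV[F]_#|Z j.-1|) (b2 : 'cV[F]_#|G j|)
    (b3 : 'cV[F]_#|Z j|) (br : 'cV[F]_#|G j.+1|) (v : 'cV[F]_#|W j|) : Prop :=
  [/\ Sl j *m restr v (G j.-1)
        + submat A (G j.-1) (Z j.-1) *m restr v (Z j.-1) = bl,
      submat A (Z j.-1) (W j) *m v = b1,
      submat A (G j) (W j) *m v = b2,
      submat A (Z j) (W j) *m v = b3
    & submat A (G j.+1) (Z j) *m restr v (Z j)
        + Sr j *m restr v (G j.+1) = br].

(* The same with a Dirichlet condition on the right interface G_(j+1). *)
Definition backward_subproblem (j : nat)
    (bl : 'cV[F]_#|G j.-1|) (b1 : 'cV[F]_#|Z j.-1|) (b2 : 'cV[F]_#|G j|)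
    (b3 : 'cV[F]_#|Z j|) (br : 'cV[F]_#|G j.+1|) (v : 'cV[F]_#|W j|) : Prop :=
  [/\ Sl j *m restr v (G j.-1)
        + submat A (G j.-1) (Z j.-1) *m restr v (Z j.-1) = bl,
      submat A (Z j.-1) (W j) *m v = b1,
      submat A (G j) (W j) *m v = b2,
      submat A (Z j) (W j) *m v = b3
    & restr v (G j.+1) = br].

Definition well_posed : Prop :=
  (forall j, (0 < j < J)%N -> forall bl b1 b2 b3 br,
     exists! v, @forward_subproblem j bl b1 b2 b3 br v) /\
  (forall j, (0 < j <= J)%N -> forall bl b1 b2 b3 br,
     exists! v, @backward_subproblem j bl b1 b2 b3 br v).

Definition transfer_conditions (j : nat) : Prop :=
  [/\ restr (D j) (G j.+1) = 0,
      submat A (G j.+1) (Z j) *m restr (D j) (Z j) = 0,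
      restr (D j - 1%:M) (G j) = 0
    & submat A (G j) (Z j) *m restr (D j - 1%:M) (Z j) = 0].

(* u is the output of the source transfer preconditioner applied to f; ft, v
   and ut are the transferred sources and the forward and backward subdomain
   solutions. Their values at indices j outside the ranges below are
   irrelevant; in particular ut (J+1) only occurs restricted to the empty set
   G_(J+1). *)
Definition source_transfer (f u : 'cV[F]_N) : Prop :=
  exists (ft : forall j, 'cV[F]_#|Z j.-1|) (v ut : forall j, 'cV[F]_#|W j|),
  [/\ ft 1%N = grestr f (Z 0) /\
      (forall j, (0 < j < J)%N ->
         forward_subproblem 0 (ft j) (grestr f (G j)) 0 0 (v j)),
      (forall j, (0 < j < J)%N ->
         ft j.+1 = grestr f (Z j)
                   - submat A (Z j) (Z j) *m restr (D j *m v j) (Z j)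
                   - submat A (Z j) (G j) *m restr (D j *m v j) (G j)),
      (forall j, (0 < j <= J)%N ->
         backward_subproblem 0 (ft j) (grestr f (G j)) (grestr f (Z j))
           (restr (ut j.+1) (G j.+1)) (ut j)),
      (forall j, (0 < j <= J)%N ->
         grestr u (G j :|: Z j) = restr (ut j) (G j :|: Z j))
    & grestr u (Z 0) = restr (ut 1%N) (Z 0)].

(* h_j; for j = 1 it is a vector over the empty set G_0. *)
Definition dosm_left_data (f : 'cV[F]_N) (uh : forall j, 'cV[F]_#|W j|)
    (j : nat) : 'cV[F]_#|G j.-1| :=
  grestr f (G j.-1)
  + (Sl j - submat A (G j.-1) (G j.-1)) *m restr (uh j.-1) (G j.-1)
  - submat A (G j.-1) (Z j.-2) *m restr (uh j.-1) (Z j.-2).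

(* u1 j = u_j^(1) results from one double sweep of the DOSM from a zero
   initial guess; uh j = u_j^(1/2). *)
Definition dosm_double_sweep (f : 'cV[F]_N) (u1 : forall j, 'cV[F]_#|W j|)
    : Prop :=
  exists uh : forall j, 'cV[F]_#|W j|,
    (forall j, (0 < j < J)%N ->
       forward_subproblem (dosm_left_data f uh j) (grestr f (Z j.-1))
         (grestr f (G j)) 0 0 (uh j)) /\
    (forall j, (0 < j <= J)%N ->
       backward_subproblem (dosm_left_data f uh j) (grestr f (Z j.-1))
         (grestr f (G j)) (grestr f (Z j))
         (restr (u1 j.+1) (G j.+1)) (u1 j)).

End Algorithms.

Arguments forward_subproblem {F N} Z G A Sl Sr [j] bl b1 b2 b3 br v.
Arguments backward_subproblem {F N} Z G A Sl [j] bl b1 b2 b3 br v.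
Arguments well_posed {F N} J Z G A Sl Sr.
Arguments transfer_conditions {F N} Z G A D j.
Arguments source_transfer {F N} J Z G A Sl Sr D f u.
Arguments dosm_double_sweep {F N} J Z G A Sl Sr f u1.

(* Main.v *)
Require Import Defs.
From HB Require Import structures.
From mathcomp Require Import all_boot all_order all_algebra.
From mathcomp Require Import zify.
From mathcomp Require Import reals.
From mathcomp Require Import complex.
Set Implicit Arguments.
Unset Strict Implicit.
Unset Printing Implicit Defensive.
Import GRing.Theory.
Local Open Scope ring_scope.

(* On subdomain j+1 the DOSM iterates, both in the forward and in the backward
   sweep, are the source transfer iterates plus one and the same correction:
   the extension by zero of (D_j v_j)[G_j U Z_j]. It turns the transferred
   source back into f[Z_j], the conditions on D_j make it invisible to the
   rows of G_(j+1) and give it the left PML data of v_j, and that is the data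
   h_(j+1) because the DOSM iterate j satisfies row G_j of the system and
   coincides with v_j on G_j U Z_j. Unique solvability then identifies the
   iterates; the correction vanishes on G_(j+1) and Z_(j+1). *)

(** * Restriction and extension by zero as products with 0/1 matrices *)

Section Selection.
Context {F : fieldType} {N : nat}.
Implicit Types (A : 'M[F]_N) (X Y U W : {set 'I_N}).

(** Both [submat] and [restr] factor through these rows of the identity, so statements about index
    sets become matrix algebra. *)
Definition selmx X : 'M[F]_(#|X|, N) :=
  rowsub (fun i : 'I_#|X| => enum_val i) 1%:M.

Lemma submat_selmx A X Y : submat A X Y = selmx X *m A *m (selmx Y)^T.
Proof.
by rewrite /selmx trmx_mxsub trmx1 -rowsubE -mxsub_mul mulmx1.
Qed.

Lemma submat1 X Y : submat 1%:M X Y = selmx X *m (selmx Y)^T.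
Proof. by rewrite submat_selmx mulmx1. Qed.

Lemma selmx_tr X : selmx X *m (selmx X)^T = 1%:M.
Proof.
by apply/matrixP => i k; rewrite -submat1 !mxE (inj_eq enum_val_inj).
Qed.

Lemma selmx_disjoint X Y : [disjoint X & Y] -> selmx X *m (selmx Y)^T = 0.
Proof.
move=> dXY; apply/matrixP => i k; rewrite -submat1 !mxE.
case: eqP => // eik; have := disjointFr dXY (enum_valP i).
by rewrite eik enum_valP.
Qed.

(** This product is the orthogonal projector onto the coordinates in [X]; inclusions and disjoint
    unions are read off its 0/1 diagonal. *)
Lemma tr_selmx_mul X :
  (selmx X)^T *m selmx X = diag_mx (\row_i (i \in X)%:R).
Proof.
apply/matrixP => i k; rewrite !mxE.
under eq_bigr do rewrite !mxE.
have [iX|iX] := boolP (i \in X); last first.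
  rewrite mul0rn big1 // => l _; case: eqP => [eli|]; last by rewrite mul0r.
  by rewrite -eli enum_valP in iX.
rewrite (bigD1 (enum_rank_in iX i)) //= enum_rankK_in // eqxx mul1r.
rewrite big1 ?addr0 // => l /eqP nl.
case: eqP => [eli|]; last by rewrite mul0r.
by case: nl; apply: enum_val_inj; rewrite enum_rankK_in.
Qed.

Lemma tr_selmx_mulU X Y : [disjoint X & Y] ->
  (selmx (X :|: Y))^T *m selmx (X :|: Y)
    = (selmx X)^T *m selmx X + (selmx Y)^T *m selmx Y.
Proof.
move=> dXY; rewrite !tr_selmx_mul -raddfD; congr diag_mx.
apply/rowP => i; rewrite !mxE inE -natrD; have := disjointFr dXY (x := i).
by case: (i \in X) => // ->.
Qed.

Lemma restr_selmx W p (M : 'M_(#|W|, p)) X :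
  restr M X = selmx X *m (selmx W)^T *m M.
Proof. by rewrite /restr submat1. Qed.

Lemma restrD W p (M M' : 'M[F]_(#|W|, p)) X :
  restr (M + M') X = restr M X + restr M' X.
Proof. exact: mulmxDr. Qed.

Lemma restr_mul W p q (M : 'M[F]_(#|W|, p)) (v : 'M_(p, q)) X :
  restr (M *m v) X = restr M X *m v.
Proof. exact: mulmxA. Qed.

(** The projector onto [X :|: Y], inserted in front of the vector, splits into those onto [X] and
    [Y]. *)
Lemma restrU W p (M M' : 'M[F]_(#|W|, p)) X Y : [disjoint X & Y] ->
  restr M X = restr M' X -> restr M Y = restr M' Y ->
  restr M (X :|: Y) = restr M' (X :|: Y).
Proof.
move=> dXY; rewrite !restr_selmx -!mulmxA => eX eY.
rewrite -[selmx (X :|: Y)]mul1mx -selmx_tr -[_ *m _ *m selmx _]mulmxA.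
by rewrite tr_selmx_mulU // -!mulmxA !mulmxDl -!mulmxA eX eY.
Qed.

(** For [X] included in [W] this is extension by zero, the transpose of the selection in [restr]. *)
Definition extend W X p (a : 'M[F]_(#|X|, p)) : 'M[F]_(#|W|, p) :=
  submat 1%:M W X *m a.

Lemma subset_selmx X W : X \subset W ->
  (selmx W)^T *m selmx W *m (selmx X)^T = (selmx X)^T.
Proof.
move=> /subsetP sXW; apply: trmx_inj; rewrite !trmx_mul !trmxK tr_selmx_mul.
apply/matrixP => i k; rewrite mul_mx_diag !mxE.
by case: eqP => [<-|]; rewrite ?mul0r // sXW ?enum_valP // mulr1.
Qed.

Lemma submat_extend A U W X p (a : 'M[F]_(#|X|, p)) : X \subset W ->
  submat A U W *m extend W a = submat A U X *m a.
Proof.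
move=> sXW; rewrite /extend submat1 !submat_selmx.
by rewrite -[in RHS](subset_selmx sXW) !mulmxA.
Qed.

Lemma restr_extend_id W X p (a : 'M[F]_(#|X|, p)) : X \subset W ->
  restr (extend W a) X = a.
Proof.
by move=> sXW; rewrite /restr submat_extend // submat1 selmx_tr
  mul1mx.
Qed.

Lemma restr_extend_disjoint W X Y p (a : 'M[F]_(#|X|, p)) : X \subset W ->
  [disjoint Y & X] -> restr (extend W a) Y = 0.
Proof.
by move=> sXW dYX; rewrite /restr submat_extend // submat1
  selmx_disjoint // mul0mx.
Qed.

End Selection.

(** * Disjointness of the blocks and sparsity of the matrix *)

Section Layers.
Context {F : fieldType} {N : nat}.
Variables (J : nat) (Z G : nat -> {set 'I_N}) (A : 'M[F]_N).
Hypotheses (hlayers : layered J Z G) (hA : block_tridiagonal J Z G A).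
Notation W := (subdomain Z G).

Lemma blockZ j : block Z G j.*2 = Z j.
Proof. by rewrite /block odd_double doubleK. Qed.

Lemma blockG j : block Z G j.*2.+1 = G j.+1.
Proof. by rewrite /block /= odd_double /= doubleK. Qed.

Lemma disjoint_blocks k l : (k < J.*2.+1)%N -> (l < J.*2.+1)%N -> k != l ->
  [disjoint block Z G k & block Z G l].
Proof.
move=> hk hl kl; case: hlayers => _ _ _ /(_ (Ordinal hk) (Ordinal hl)).
exact.
Qed.

Lemma cV_set0 (X : {set 'I_N}) (a b : 'cV[F]_#|X|) : X = set0 -> a = b.
Proof.
move=> X0; move: a b; rewrite X0 => a b; apply/colP => i.
by have := enum_valP i; rewrite inE.
Qed.

Lemma submat_far k l : (k < J.*2.+1)%N -> (l < J.*2.+1)%N ->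
  (k.+1 < l)%N || (l.+1 < k)%N ->
  submat A (block Z G k) (block Z G l) = 0.
Proof. by move=> hk hl; apply: (@hA (Ordinal hk) (Ordinal hl)). Qed.

Lemma disjointZZ i j : (i <= J)%N -> (j <= J)%N -> i != j ->
  [disjoint Z i & Z j].
Proof. by move=> ? ? ?; rewrite -!blockZ disjoint_blocks //; lia. Qed.

Lemma set0_disjoint (X : {set 'I_N}) : [disjoint set0 & X].
Proof. by rewrite -setI_eq0 set0I. Qed.

(** The sets [G 0] and [G J.+1] are not among the numbered blocks; they are treated apart, as empty
    sets. *)
Lemma disjointGZ i j : (i <= J.+1)%N -> (j <= J)%N -> [disjoint G i & Z j].
Proof.
have [G0 GJ _ _] := hlayers.
case: i => [|i] hi hj; first by rewrite G0 set0_disjoint.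
have [eij|neij] := eqVneq i J; first by rewrite eij GJ set0_disjoint.
by rewrite -blockZ -blockG disjoint_blocks //; lia.
Qed.

Lemma disjoint_setU (X Y U : {set 'I_N}) :
  [disjoint X :|: Y & U] = [disjoint X & U] && [disjoint Y & U].
Proof. by rewrite -!setI_eq0 setIUl setU_eq0. Qed.

Lemma disjointZG i j : (i <= J)%N -> (j <= J.+1)%N -> [disjoint Z i & G j].
Proof. by move=> *; rewrite disjoint_sym disjointGZ. Qed.

Lemma disjointGG i j : (i <= J.+1)%N -> (j <= J.+1)%N -> i != j ->
  [disjoint G i & G j].
Proof.
have [G0 GJ _ _] := hlayers.
case: i => [|i] hi hj ij; first by rewrite G0 set0_disjoint.
have [eij|neij] := eqVneq i J; first by rewrite eij GJ set0_disjoint.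
rewrite disjoint_sym; case: j hj ij => [|j] hj ij.
  by rewrite G0 set0_disjoint.
have [ejJ|nejJ] := eqVneq j J; first by rewrite ejJ GJ set0_disjoint.
by rewrite -!blockG disjoint_blocks //; lia.
Qed.

Lemma submat_set0r X (M : 'M[F]_N) Y : Y = set0 -> submat M X Y = 0.
Proof.
by move=> ->; apply/matrixP => i k; have := enum_valP k; rewrite inE.
Qed.

(** Distinct interfaces have odd block numbers, hence lie at least two blocks apart. *)
Lemma submatGG0 i j : (0 < i <= J)%N -> (j <= J.+1)%N -> i != j ->
  submat A (G i) (G j) = 0.
Proof.
have [G0 GJ _ _] := hlayers.
case: i => // i hi; case: j => [|j] hj ij; first exact: submat_set0r.
have [ejJ|nejJ] := eqVneq j J; first by rewrite ejJ submat_set0r.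
by rewrite -!blockG submat_far //; lia.
Qed.

Lemma submatZZ0 i j : (i <= J)%N -> (j <= J)%N -> i != j ->
  submat A (Z i) (Z j) = 0.
Proof. by move=> ? ? ?; rewrite -!blockZ submat_far //; lia. Qed.

Lemma submatZG0 j : (j < J)%N -> submat A (Z j.+1) (G j) = 0.
Proof.
have [G0 _ _ _] := hlayers.
case: j => [|j] hj; first exact: submat_set0r.
by rewrite -blockZ -blockG submat_far //; lia.
Qed.

(** The five pieces of the subdomain are pairwise disjoint, so the projector onto it is the sum of
    their projectors. *)
Lemma submat_subdomain (M : 'M[F]_N) U j (v : 'cV_#|W j.+1|) : (j < J)%N ->
  submat M U (W j.+1) *m v
    = submat M U (G j) *m restr v (G j) + submat M U (Z j) *m restr v (Z j)
      + submat M U (G j.+1) *m restr v (G j.+1)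
      + submat M U (Z j.+1) *m restr v (Z j.+1)
      + submat M U (G j.+2) *m restr v (G j.+2).
Proof.
move=> hj; rewrite !submat_selmx !restr_selmx -!mulmxA -!mulmxDr.
congr (_ *m (_ *m _)); rewrite -[LHS]mulmx1.
(* Writing the identity on the subdomain as [selmx] times its transpose makes the projector appear
   on the left. *)
rewrite -{1}[v]mul1mx -selmx_tr !mulmx1 !mulmxA -!mulmxDl.
congr (_ *m _ *m _); rewrite /subdomain /=.
rewrite !tr_selmx_mulU //; rewrite ?disjoint_setU;
  by rewrite ?disjointZG ?disjointGZ ?disjointGG ?disjointZZ //; lia.
Qed.

End Layers.

(** * The correction between the two methods *)

Section SourceTransfer.
Context {F : fieldType} {N : nat}.
Variables (J : nat) (Z G : nat -> {set 'I_N}) (A : 'M[F]_N).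
Hypotheses (hlayers : layered J Z G) (hA : block_tridiagonal J Z G A).
Variables (Sl : forall j, 'M[F]_#|G j.-1|) (Sr : forall j, 'M[F]_#|G j.+1|).
Notation W := (subdomain Z G).
Variable D : forall j, 'M[F]_#|W j|.
Hypothesis hD : forall j, (0 < j < J)%N -> transfer_conditions Z G A D j.
Variables (f : 'cV[F]_N) (ft : forall j, 'cV[F]_#|Z j.-1|).
Variable v : forall j, 'cV[F]_#|W j|.
Hypothesis ft1 : ft 1%N = grestr f (Z 0).
Hypothesis ftS : forall j, (0 < j < J)%N ->
  ft j.+1 = grestr f (Z j)
            - submat A (Z j) (Z j) *m restr (D j *m v j) (Z j)
            - submat A (Z j) (G j) *m restr (D j *m v j) (G j).

(** The first subdomain receives no transferred source, so its correction is zero; index 0 only gets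
    a default. [G] and [Z] parts are kept apart because the conditions on [D] treat them
    differently. *)
Definition correction j : 'cV[F]_#|W j| :=
  match j with
  | i.+2 => extend (W i.+2) (restr (D i.+1 *m v i.+1) (G i.+1))
            + extend (W i.+2) (restr (D i.+1 *m v i.+1) (Z i.+1))
  | _ => 0
  end.

Lemma subG_subdomain j : G j \subset W j.+1.
Proof. by apply/subsetP => x; rewrite !inE /= => ->. Qed.

Lemma subZ_subdomain j : Z j \subset W j.+1.
Proof. by apply/subsetP => x; rewrite !inE /= => ->; rewrite !orbT. Qed.

Lemma submat_correction (M : 'M_N) U j :
  submat M U (W j.+2) *m correction j.+2
    = submat M U (G j.+1) *m restr (D j.+1 *m v j.+1) (G j.+1)
      + submat M U (Z j.+1) *m restr (D j.+1 *m v j.+1) (Z j.+1).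
Proof.
by rewrite mulmxDr (submat_extend _ _ _ (subG_subdomain j.+1))
  (submat_extend _ _ _ (subZ_subdomain j.+1)).
Qed.

Lemma restr_correctionG j : (j.+1 < J)%N ->
  restr (correction j.+2) (G j.+1) = restr (D j.+1 *m v j.+1) (G j.+1).
Proof.
move=> hj; rewrite restrD restr_extend_id ?subG_subdomain //.
rewrite restr_extend_disjoint ?addr0 ?subZ_subdomain //.
by apply: (disjointGZ hlayers); lia.
Qed.

Lemma restr_correctionZ j : (j.+1 < J)%N ->
  restr (correction j.+2) (Z j.+1) = restr (D j.+1 *m v j.+1) (Z j.+1).
Proof.
move=> hj; rewrite restrD [X in _ + X]restr_extend_id ?subZ_subdomain //.
rewrite restr_extend_disjoint ?add0r ?subG_subdomain //.
by apply: (disjointZG hlayers); lia.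
Qed.

(** The support lies in [G j.-1] and [Z j.-1]; for [j = 1] it is empty, hence the guard on
    disjointness. *)
Lemma restr_correction0 j (X : {set 'I_N}) : (0 < j <= J)%N ->
  ((1 < j)%N -> [disjoint X & G j.-1] /\ [disjoint X & Z j.-1]) ->
  restr (correction j) X = 0.
Proof.
case: j => [|[|j]] // hj dX; first by rewrite /restr mulmx0.
have [|dXG dXZ] := dX; first by [].
by rewrite restrD !restr_extend_disjoint ?addr0
  ?subG_subdomain ?subZ_subdomain.
Qed.

Lemma restr_correction_G j : (0 < j <= J)%N ->
  restr (correction j) (G j) = 0.
Proof.
move=> hj; apply: restr_correction0 => // j1; split.
  by apply: (disjointGG hlayers); lia.
by apply: (disjointGZ hlayers); lia.
Qed.

Lemma restr_correction_Z j : (0 < j <= J)%N ->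
  restr (correction j) (Z j) = 0.
Proof.
move=> hj; apply: restr_correction0 => // j1; split.
  by apply: (disjointZG hlayers); lia.
by apply: (disjointZZ hlayers); lia.
Qed.

Lemma restr_correction_GS j : (0 < j <= J)%N ->
  restr (correction j) (G j.+1) = 0.
Proof.
move=> hj; apply: restr_correction0 => // j1; split.
  by apply: (disjointGG hlayers); lia.
by apply: (disjointGZ hlayers); lia.
Qed.

(** * Effect of the correction on each row of a subproblem *)

(** The rows of [Z j.-1] return exactly what the source transfer subtracted from [f]. *)
Lemma correction_row_Zp j : (0 < j <= J)%N ->
  submat A (Z j.-1) (W j) *m correction j = grestr f (Z j.-1) - ft j.
Proof.
case: j => [|[|j]] // hj; first by rewrite mulmx0 ft1 subrr.
rewrite submat_correction ftS // -addrA -opprD subKr.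
by rewrite addrC.
Qed.

(** The [G j.-1] part is cancelled by tridiagonality, the [Z j.-1] part by the second condition on
    [D j.-1]. *)
Lemma correction_row_G j : (0 < j <= J)%N ->
  submat A (G j) (W j) *m correction j = 0.
Proof.
case: j => [|[|j]] // hj; first by rewrite mulmx0.
have [_ dZ _ _] := hD (j := j.+1) hj.
rewrite submat_correction !restr_mul (mulmxA _ (restr _ (Z _))) dZ mul0mx.
by rewrite (submatGG0 hlayers hA) ?mul0mx ?addr0 //; lia.
Qed.

Lemma correction_row_Z j : (0 < j <= J)%N ->
  submat A (Z j) (W j) *m correction j = 0.
Proof.
case: j => [|[|j]] // hj; first by rewrite mulmx0.
rewrite submat_correction (submatZZ0 hA) ?(submatZG0 hlayers hA) //; try lia.
by rewrite !mul0mx addr0.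
Qed.

(** The last two transfer conditions allow [D j.+1] to be replaced by the identity in these two
    terms. *)
Lemma correction_left_data j : (j.+1 < J)%N ->
  Sl j.+2 *m restr (correction j.+2) (G j.+1)
    + submat A (G j.+1) (Z j.+1) *m restr (correction j.+2) (Z j.+1)
  = Sl j.+2 *m restr (v j.+1) (G j.+1)
    + submat A (G j.+1) (Z j.+1) *m restr (v j.+1) (Z j.+1).
Proof.
move=> hj; have [_ _ dG dZ] := hD (j := j.+1) hj.
rewrite restr_correctionG // restr_correctionZ //.
have dv : D j.+1 *m v j.+1 = (D j.+1 - 1%:M) *m v j.+1 + v j.+1.
  by rewrite mulmxBl mul1mx subrK.
rewrite dv !restrD !restr_mul dG mul0mx add0r mulmxDr mulmxA dZ mul0mx.
by rewrite add0r.
Qed.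

(** Substituting row [G j.+1] for [f] cancels the terms of the left data on [A[G j.+1, G j.+1]] and
    [A[G j.+1, Z j]]; what remains is the PML expression seen from the right. *)
Lemma dosm_left_dataE (uh : forall j, 'cV[F]_#|W j|) j : (j.+1 < J)%N ->
  submat A (G j.+1) (W j.+1) *m uh j.+1 = grestr f (G j.+1) ->
  dosm_left_data A Sl f uh j.+2
    = Sl j.+2 *m restr (uh j.+1) (G j.+1)
      + submat A (G j.+1) (Z j.+1) *m restr (uh j.+1) (Z j.+1).
Proof.
move=> hj; rewrite /dosm_left_data /= => <-.
rewrite (submat_subdomain hlayers); last by lia.
rewrite (submatGG0 hlayers hA (j := j)) ?(submatGG0 hlayers hA (j := j.+2));
  try lia.
rewrite !mul0mx add0r addr0 mulmxBl -addrA addrC -!addrA; congr (_ + _).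
by rewrite !addKr.
Qed.

(** Serves both sweeps, whose left data come from the same forward iterates. For [j = 1] the
    assumption on the predecessor is vacuous and both sides live on the empty [G 0]. *)
Lemma correction_left (uh : forall j, 'cV[F]_#|W j|) j : (0 < j <= J)%N ->
  (forall i, i.+1 = j -> (0 < i)%N ->
     submat A (G i) (W i) *m uh i = grestr f (G i) /\
     uh i = v i + correction i) ->
  Sl j *m restr (correction j) (G j.-1)
    + submat A (G j.-1) (Z j.-1) *m restr (correction j) (Z j.-1)
  = dosm_left_data A Sl f uh j.
Proof.
case: j => [|[|j]] // hj huh.
  by apply: cV_set0; have [] := hlayers.
have [|//|eG euh] := huh j.+1; first by [].
rewrite correction_left_data // dosm_left_dataE // euh !restrD.
(* The preceding correction vanishes on [G j.+1] and [Z j.+1], so [uh j.+1] and [v j.+1] agree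
   there. *)
by rewrite restr_correction_G ?restr_correction_Z ?addr0 //; lia.
Qed.

(** * Identification of the iterates in the two sweeps *)

Hypothesis hwp : well_posed J Z G A Sl Sr.
Hypothesis hv : forall j, (0 < j < J)%N ->
  forward_subproblem Z G A Sl Sr 0 (ft j) (grestr f (G j)) 0 0 (v j).

Lemma forward_correction (uh : forall j, 'cV[F]_#|W j|) :
  (forall j, (0 < j < J)%N ->
     forward_subproblem Z G A Sl Sr (dosm_left_data A Sl f uh j)
       (grestr f (Z j.-1)) (grestr f (G j)) 0 0 (uh j)) ->
  forall j, (0 < j < J)%N -> uh j = v j + correction j.
Proof.
move=> huh; elim=> // j IHj hj; have hjJ : (0 < j.+1 <= J)%N by lia.
have [vl v1 v2 v3 vr] := hv hj.
(* With the DOSM data, [uh j.+1] is a solution by assumption; the corrected [v j.+1] is now shown to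
   be another. *)
have [w [_ w_uniq]] := hwp.1 _ hj (dosm_left_data A Sl f uh j.+1)
  (grestr f (Z j)) (grestr f (G j.+1)) 0 0.
rewrite -(w_uniq _ (huh _ hj)); apply: w_uniq; split.
- rewrite !restrD !mulmxDr addrACA vl add0r.
  rewrite (correction_left (uh := uh)) // => i [->] j0.
  have hj' : (0 < j < J)%N by lia.
  by split; [have [] := huh j hj' | apply: IHj].
- by rewrite mulmxDr v1 (correction_row_Zp hjJ) subrKC.
- by rewrite mulmxDr v2 correction_row_G // addr0.
- by rewrite mulmxDr v3 correction_row_Z // addr0.
- rewrite !restrD restr_correction_Z // restr_correction_GS //.
  by rewrite !addr0.
Qed.

Lemma backward_correction (uh ut u1 : forall j, 'cV[F]_#|W j|) :
  (forall j, (0 < j < J)%N ->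
     forward_subproblem Z G A Sl Sr (dosm_left_data A Sl f uh j)
       (grestr f (Z j.-1)) (grestr f (G j)) 0 0 (uh j)) ->
  (forall j, (0 < j <= J)%N ->
     backward_subproblem Z G A Sl 0 (ft j) (grestr f (G j)) (grestr f (Z j))
       (restr (ut j.+1) (G j.+1)) (ut j)) ->
  (forall j, (0 < j <= J)%N ->
     backward_subproblem Z G A Sl (dosm_left_data A Sl f uh j)
       (grestr f (Z j.-1)) (grestr f (G j)) (grestr f (Z j))
       (restr (u1 j.+1) (G j.+1)) (u1 j)) ->
  forall j, (0 < j <= J)%N -> u1 j = ut j + correction j.
Proof.
move=> huh hut hu1.
(* The left data are already known from the forward sweep, so only agreement of the Dirichlet data
   links neighbouring subdomains. *)
have step j : (0 < j <= J)%N ->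
    restr (ut j.+1) (G j.+1) = restr (u1 j.+1) (G j.+1) ->
    u1 j = ut j + correction j.
  case: j => // j hj eG; have [vl v1 v2 v3 vr] := hut _ hj.
  have [w [_ w_uniq]] := hwp.2 _ hj (dosm_left_data A Sl f uh j.+1)
    (grestr f (Z j)) (grestr f (G j.+1)) (grestr f (Z j.+1))
    (restr (u1 j.+2) (G j.+2)).
  rewrite -(w_uniq _ (hu1 _ hj)); apply: w_uniq; split.
  - rewrite !restrD !mulmxDr addrACA vl add0r.
    rewrite (correction_left (uh := uh)) // => i [->] j0.
    have hj' : (0 < j < J)%N by lia.
    by split; [have [] := huh j hj' | apply: forward_correction].
  - by rewrite mulmxDr v1 (correction_row_Zp hj) subrKC.
  - by rewrite mulmxDr v2 correction_row_G // addr0.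
  - by rewrite mulmxDr v3 correction_row_Z // addr0.
  - by rewrite restrD restr_correction_GS // addr0 vr.
(* Descending induction on [j], run on the distance [k] to [J]. *)
suff down k j : (j + k)%N = J -> (0 < j)%N -> u1 j = ut j + correction j.
  by move=> j /andP[j0 jJ]; apply: (down (J - j)%N); rewrite ?subnKC.
elim: k j => [|k IHk] j ejk j0; apply: step; try lia.
  (* The sweep starts with Dirichlet data on the empty [G J.+1], which agree trivially. *)
  have -> : j = J by lia.
  by apply: cV_set0; have [] := hlayers.
(* The correction on subdomain [j.+1] vanishes on [G j.+1], so both methods pass on the same
   Dirichlet data. *)
rewrite [u1 j.+1]IHk //; last by lia.
by rewrite restrD restr_correction_G ?addr0 //; lia.
Qed.

End SourceTransfer.

Theorem theorem8p2 (R : realType) (N J : nat) (Z G : nat -> {set 'I_N})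
    (A : 'M[complex R]_N)
    (Sl : forall j, 'M[complex R]_#|G j.-1|)
    (Sr : forall j, 'M[complex R]_#|G j.+1|)
    (D : forall j, 'M[complex R]_#|subdomain Z G j|)
    (hJ : (0 < J)%N)
    (hlayers : layered J Z G)
    (hA : block_tridiagonal J Z G A)
    (hD : forall j, (0 < j < J)%N -> transfer_conditions Z G A D j)
    (hwp : well_posed J Z G A Sl Sr)
    (f u : 'cV[complex R]_N)
    (u1 : forall j, 'cV[complex R]_#|subdomain Z G j|)
    (hu : source_transfer J Z G A Sl Sr D f u)
    (hu1 : dosm_double_sweep J Z G A Sl Sr f u1) :
  (forall j, (0 < j <= J)%N ->
     grestr u (G j :|: Z j) = restr (u1 j) (G j :|: Z j)) /\
  grestr u (Z 0%N) = restr (u1 1%N) (Z 0%N).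
Proof.
have [ft [v [ut [[ft1 hv] ftS hut uE u0E]]]] := hu.
have [uh [huh hub]] := hu1.
have u1E := backward_correction hlayers hA hD ft1 ftS hwp hv huh hut hub.
(* On [Z 0] the first correction is zero by definition; on [G j :|: Z j] it vanishes piecewise. *)
split=> [j hj|]; last by rewrite u0E u1E //= addr0.
rewrite uE // u1E //; apply: restrU; rewrite ?restrD.
- by apply: (disjointGZ hlayers); lia.
- by rewrite (restr_correction_G hlayers) ?addr0.
- by rewrite (restr_correction_Z hlayers) ?addr0.
Qed.
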